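(* For $A,B\in\mathbb{C}_{n,n}$ with core-EP decompositions $A=A_1+A_2$ and $B=B_1+B_2$, define the C-E order by $$A\mathop{\le}\limits^{\mathrm{CE}}B\quad\text{if and only if}\quad A_1\mathop{\le}\limits^{\#}B_1\ \text{ and }\ A_2\mathop{\le}\limits^{-}B_2 .$$ Then $\mathop{\le}\limits^{\mathrm{CE}}$ is a partial order on $\mathbb{C}_{n,n}$ (i.e. it is reflexive, transitive and anti-symmetric).
   Context: $\mathbb{C}_{n,n}$ is the set of complex $n\times n$ matrices and $A^\ast$ the conjugate transpose. The index $\mathrm{Ind}(A)$ is the smallest positive integer $k$ with $\mathrm{rk}(A^{k+1})=\mathrm{rk}(A^k)$. Core-EP decomposition (known): every $A\in\mathbb{C}_{n,n}$ with $\mathrm{Ind}(A)=k$ can be written uniquely as $A=A_1+A_2$ with $\mathrm{Ind}(A_1)=1$, $A_2^k=0$ and $A_1^\ast A_2=A_2A_1=0$ (one or both may be null). For a matrix $M$ of index one, the group inverse $M^\#$ is the unique $X$ with $XM^2=M$, $XMX=X$, $MX=XM$. The sharp partial order on matrices of index one: $M\mathop{\le}\limits^{\#}M'$ means $MM^\#=M'M^\#$ and $M^\#M=M^\#M'$. The minus partial order: $M\mathop{\le}\limits^{-}M'$ means $\mathrm{rk}(M'-M)=\mathrm{rk}(M')-\mathrm{rk}(M)$. *)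

(* Defs.v *)
From mathcomp Require Import all_boot all_order all_algebra.
From mathcomp Require Import reals complex.
From Corelib Require Relation_Definitions.

Set Implicit Arguments.
Unset Strict Implicit.
Unset Printing Implicit Defensive.

Import GRing.Theory Num.Theory.
Local Open Scope ring_scope.
Local Open Scope sesquilinear_scope.

Fact mxindex_exists (C : fieldType) (n : nat) (A : 'M[C]_n) :
  exists k : nat, (0 < k)%N && (\rank (A ^+ k.+1) == \rank (A ^+ k)).
Proof.
have [/existsP[k /eqP rk]|/existsPn nrk] :=
  boolP [exists k : 'I_n.+1, \rank (A ^+ k.+2) == \rank (A ^+ k.+1)].
  by exists k.+1; rewrite rk eqxx.
suff le_rk m : (m <= n.+1)%N -> (\rank (A ^+ m.+1) + m <= n)%N.
  by have := leq_trans (leq_addl _ _) (le_rk n.+1 (leqnn _)); rewrite ltnn.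
elim: m => [|m IHm] lt_mn; first by rewrite addn0 rank_leq_row.
apply: leq_trans (IHm (ltnW lt_mn)); rewrite addnS ltn_add2r.
have := nrk (Ordinal lt_mn); rewrite ltn_neqAle /= => -> /=.
by rewrite exprSr -mulmxE mxrankM_maxl.
Qed.

(* The zero matrix and the invertible matrices have index 1, since only
   positive exponents are considered. *)
Definition mxindex (C : fieldType) (n : nat) (A : 'M[C]_n) : nat :=
  ex_minn (mxindex_exists A).

Definition is_core_EP (C : numClosedFieldType) (n : nat)
    (A A1 A2 : 'M[C]_n) : Prop :=
  [/\ A = A1 + A2,
      mxindex A1 = 1%N,
      A2 ^+ mxindex A = 0,
      A1 ^t* *m A2 = 0
    & A2 *m A1 = 0].

Definition is_group_inv (C : fieldType) (n : nat) (M X : 'M[C]_n) : Prop :=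
  [/\ X *m M ^+ 2 = M, X *m M *m X = X & M *m X = X *m M].

Lemma is_group_inv_uniq (C : fieldType) (n : nat) (M X Y : 'M[C]_n) :
  is_group_inv M X -> is_group_inv M Y -> X = Y.
Proof.
rewrite /is_group_inv expr2 -mulmxE => -[XMM XMX MX] [YMM YMY MY].
have MXE : M *m X = Y *m M.
  by rewrite -{1}YMM -!mulmxA MX !mulmxA -(mulmxA Y) MX -(mulmxA Y) -(mulmxA X) XMM.
by rewrite -XMX -MX MXE -mulmxA MXE -MY mulmxA YMY.
Qed.

Definition sharp_le (C : fieldType) (n : nat) (M M' : 'M[C]_n) : Prop :=
  [/\ mxindex M = 1%N, mxindex M' = 1%N
    & exists X, [/\ is_group_inv M X, M *m X = M' *m X & X *m M = X *m M']].

(* Ranks are subtracted in [int] because subtraction in [nat] is truncated. *)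
Definition minus_le (C : fieldType) (n : nat) (M M' : 'M[C]_n) : Prop :=
  (\rank (M' - M))%:Z = (\rank M')%:Z - (\rank M)%:Z.

(* The core-EP decomposition exists and is unique for every matrix, so the
   quantified matrices are the components of A and B. *)
Definition CE_le (C : numClosedFieldType) (n : nat) (A B : 'M[C]_n) : Prop :=
  exists A1 A2 B1 B2 : 'M[C]_n,
    [/\ is_core_EP A A1 A2, is_core_EP B B1 B2, sharp_le A1 B1
      & minus_le A2 B2].

(* Main.v *)
Require Import Defs.
From mathcomp Require Import all_boot all_order all_algebra.
From mathcomp Require Import reals complex.
From Corelib Require Relation_Definitions.

(** The relation is the conjunction of two partial orders, transported along
    the map sending [A] to the pair [(A1, A2)] of its core-EP components; so
    all that has to be known besides the two orders is that this map is total
    and single-valued.  (It is injective because [A = A1 + A2].)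

    Both facts about the decomposition come from one orthogonal projector [P],
    the one onto the column space of [A ^+ k], where [k] is the index of [A].
    Since [M] and [M^t* *m M] have the same row space, there is [Z] with
    [M = Z *m M^t* *m M], and [P := Z *m M^t*] is automatically Hermitian and
    idempotent ([ortho_projector_exists]).  The pair [P A], [(1 - P) A] is a
    core-EP decomposition because [A] maps the column space of [A ^+ k] onto
    itself ([core_EP_exists]).  Conversely, in any decomposition [A1] has the
    same column space as [A ^+ k] and the columns of [A2] are orthogonal to it,
    which forces [A1 = P A] ([core_EP_uniq]).

    A matrix of index one has a group inverse ([index1_group_inv]), which gives
    reflexivity of the sharp order; its transitivity and antisymmetry are
    computations with group inverses.  For the minus order the three properties
    follow from subadditivity of the rank. *)

Set Implicit Arguments.
Unset Strict Implicit.
Unset Printing Implicit Defensive.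

Import Order.TTheory GRing.Theory Num.Theory.
Local Open Scope ring_scope.
Local Open Scope sesquilinear_scope.

(** * Rank, index one and the group inverse *)

Section IndexOne.

Variables (C : fieldType) (n : nat).
Implicit Types M X : 'M[C]_n.

Lemma rank_mulmx_factorl m p q (M : 'M[C]_(m, p)) (N : 'M[C]_(p, q)) :
  \rank (M *m N) = \rank N -> exists Y, N = Y *m (M *m N).
Proof.
move=> rkMN; apply/submxP.
by have [_ <-] := mxrank_leqif_sup (submxMl M N); rewrite rkMN.
Qed.

Lemma rank_mulmx_factorr m p q (M : 'M[C]_(m, p)) (N : 'M[C]_(p, q)) :
  \rank (M *m N) = \rank M -> exists Z, M = M *m N *m Z.
Proof.
move=> rkMN.
have [|Y defM] := @rank_mulmx_factorl _ _ _ N^T M^T.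
  by rewrite -trmx_mul !mxrank_tr.
by exists Y^T; apply: trmx_inj; rewrite trmx_mul trmxK trmx_mul.
Qed.

Lemma rank_mxindex M : \rank (M ^+ (mxindex M).+1) = \rank (M ^+ mxindex M).
Proof. by rewrite /mxindex; case: ex_minnP => k /andP[_ /eqP]. Qed.

Lemma mxindex_eq1_rank M : mxindex M = 1%N <-> \rank (M *m M) = \rank M.
Proof.
split=> [indM|rkM]; first by have := rank_mxindex M; rewrite indM.
rewrite /mxindex; case: ex_minnP => k /andP[k_gt0 _] /(_ 1%N).
rewrite expr2 expr1 -mulmxE rkM eqxx => /(_ isT) k_le1.
by apply/eqP; rewrite eqn_leq k_le1.
Qed.

Lemma mxindex_eq1 M : mxindex M = 1%N <-> exists Z, M = M *m M *m Z.
Proof.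
rewrite mxindex_eq1_rank; split=> [/rank_mulmx_factorr//|[Z defM]].
by apply/eqP; rewrite eqn_leq mxrankM_maxl {1}defM mxrankM_maxl.
Qed.

(** A factorization [M = Y M M = M M Z] suffices: then [Y M = M Z] is the
    idempotent with the row and column space of [M], and [M Z Z] inverts [M]
    there. *)
Lemma index1_group_inv M : mxindex M = 1%N -> exists X, is_group_inv M X.
Proof.
move=> /mxindex_eq1_rank rkM.
have [Y defMl] := rank_mulmx_factorl rkM.
have [Z defMr] := rank_mulmx_factorr rkM.
have YM : Y *m M = M *m Z by rewrite {1}defMr !mulmxA -(mulmxA Y) -defMl.
have YYM : Y *m Y *m M = M *m Z *m Z by rewrite -YM -!mulmxA YM mulmxA.
have XM : M *m Z *m Z *m M = M *m Z.
  by rewrite -YYM -!mulmxA -defMl YM.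
have MZM : M *m Z *m M = M by rewrite -YM -mulmxA -defMl.
exists (M *m Z *m Z); split.
- by rewrite expr2 -mulmxE mulmxA XM MZM.
- by rewrite XM !mulmxA MZM.
- by rewrite XM !mulmxA -defMr.
Qed.

Lemma group_inv_idem M X : is_group_inv M X -> M *m X *m M = M.
Proof. by case; rewrite expr2 -mulmxE mulmxA => XMM _ ->. Qed.

End IndexOne.

(** * The sharp and the minus order *)

Section SharpMinus.

Variables (C : fieldType) (n : nat).
Implicit Types M : 'M[C]_n.

Lemma sharp_le_refl M : mxindex M = 1%N -> sharp_le M M.
Proof.
move=> indM; have [X invX] := index1_group_inv indM.
by split=> //; exists X.
Qed.

(** The idempotent [M' X'] acts as the identity on [X] from both sides, since
    the row and column spaces of [X], those of [M], lie in those of [M'];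
    hence [M''] may replace [M'] next to [X]. *)
Lemma sharp_le_trans M M' M'' :
  sharp_le M M' -> sharp_le M' M'' -> sharp_le M M''.
Proof.
case=> indM _ [X [invX MX XM]] [_ indM'' [X' [invX' MX' XM']]].
split=> //; exists X; split=> //.
  have idX : X = X' *m M' *m X.
    have [_ XMX MXC] := invX; have [_ _ <-] := invX'.
    have defX : X = M' *m X *m X by rewrite -MX MXC XMX.
    by rewrite {2}defX !mulmxA (group_inv_idem invX') -defX.
  by rewrite MX [in RHS]idX !mulmxA -MX' (group_inv_idem invX').
have idX : X = X *m M' *m X'.
  have [_ XMX MXC] := invX; have [_ _ M'X'] := invX'.
  have defX : X = X *m X *m M' by rewrite -mulmxA -XM -MXC mulmxA XMX.
  rewrite -mulmxA M'X' {2}defX -!mulmxA (mulmxA M') (group_inv_idem invX').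
  by rewrite mulmxA -defX.
rewrite XM [in RHS]idX -!mulmxA -XM' (mulmxA M').
by rewrite (group_inv_idem invX').
Qed.

(** Both [M] and [M'] are equal to [M *m X *m M'], where [X] is the group
    inverse of [M]. *)
Lemma sharp_le_antisym M M' : sharp_le M M' -> sharp_le M' M -> M = M'.
Proof.
case=> _ _ [X [invX _ XM]] [_ _ [X' [invX' MX' _]]].
rewrite -(group_inv_idem invX) -mulmxA XM mulmxA.
by rewrite -(group_inv_idem invX') MX' !mulmxA (group_inv_idem invX).
Qed.

Lemma minus_le_refl M : minus_le M M.
Proof. by rewrite /minus_le !subrr mxrank0. Qed.

Lemma minus_le_trans M M' M'' :
  minus_le M M' -> minus_le M' M'' -> minus_le M M''.
Proof.
rewrite /minus_le => leMM' leM'M''; apply/eqP; rewrite eq_le; apply/andP; split.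
  rewrite -(subrKA (\rank M')%:Z) -leMM' -leM'M'' -PoszD lez_nat.
  by rewrite -(subrKA M'); apply: mxrank_add.
rewrite lerBlDr -PoszD lez_nat -{1}(subrK M M'').
exact: mxrank_add.
Qed.

Lemma minus_le_antisym M M' : minus_le M M' -> minus_le M' M -> M = M'.
Proof.
rewrite /minus_le => leMM'.
rewrite -(opprB M' M) mxrank_opp -(opprB _%:Z) -leMM'.
(* the two differences of ranks are opposite, and equal to one rank *)
move=> rkN; have : ((\rank (M' - M))%:Z <= 0)%R by rewrite rkN oppr_le0.
by rewrite lez_nat leqn0 mxrank_eq0 subr_eq0 => /eqP.
Qed.

End SharpMinus.

(** * Orthogonal projectors *)

Section CoreEP.

Variables (C : numClosedFieldType) (n : nat).
Implicit Types A B P : 'M[C]_n.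

Lemma trmxC_mul m p q (M : 'M[C]_(m, p)) (N : 'M[C]_(p, q)) :
  (M *m N)^t* = N^t* *m M^t*.
Proof. by rewrite trmx_mul map_mxM. Qed.

Lemma gram_eq0 m p (N : 'M[C]_(m, p)) : N^t* *m N = 0 -> N = 0.
Proof.
move=> NN0; apply/matrixP=> i j; rewrite mxE.
have /matrixP/(_ j j) := NN0; rewrite !mxE => /eqP.
rewrite psumr_eq0 => [/allP/(_ i (mem_index_enum i))|k _].
  by rewrite !mxE /= mulrC mul_conjC_eq0 => /eqP.
by rewrite !mxE mulrC mul_conjC_ge0.
Qed.

(** A vector killed by [M^t* *m M] is killed by [M], so [M] factors through
    its Gram matrix: [M = Z *m M^t* *m M].  Then [P := Z *m M^t*] satisfies
    [P *m P^t* = P^t*], which makes it Hermitian. *)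
Lemma ortho_projector_exists m (M : 'M[C]_(n, m)) :
  exists (Z : 'M[C]_(n, m)) (P : 'M[C]_n),
    [/\ P = Z *m M^t*, P = M *m Z^t* & P *m M = M].
Proof.
have /submxP[Z defM] : (M <= M^t* *m M)%MS.
  rewrite submxE; apply/eqP/gram_eq0.
  by rewrite trmxC_mul -!mulmxA (mulmxA (M^t* )) mulmx_coker mulmx0.
have PM : Z *m M^t* *m M = M by rewrite -mulmxA -defM.
exists Z, (Z *m M^t*); split=> //.
have PC : (Z *m M^t*)^t* = M *m Z^t* by rewrite trmxC_mul trmxCK.
have PP : Z *m M^t* *m (M *m Z^t*) = M *m Z^t* by rewrite mulmxA PM.
by rewrite -{1}[Z *m _]trmxCK PC -{1}PP trmxC_mul -PC trmxCK PC.
Qed.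

(** * The core-EP decomposition *)

(** With [P] the orthogonal projector onto the column space of [A ^+ k], take
    [A1 = P A] and [A2 = (1 - P) A].  Invariance of that space under [A], in
    the form [P A P = A P], gives [A2 A1 = 0] and [A2 ^+ j = (1 - P) A ^+ j]
    for positive [j], hence [A2 ^+ k = 0].  As [k] is the index of [A], the
    matrix [A] is invertible on that space, so [A1] has index one. *)
Lemma core_EP_exists A : exists A1 A2, is_core_EP A A1 A2.
Proof.
set k := mxindex A.
have [Z [P [PZ PM idP]]] := ortho_projector_exists (A ^+ k).
have PC : P^t* = P by rewrite {1}PZ trmxC_mul trmxCK -PM.
have PP : P *m P = P by rewrite {2}PM mulmxA idP -PM.
have AkE : A ^+ k.+1 = A *m A ^+ k by rewrite exprS mulmxE.
have AkC : A *m A ^+ k = A ^+ k *m A by rewrite -AkE exprSr.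
(* the column space of [A ^+ k] is invariant under [A] *)
have PAP : P *m A *m P = A *m P.
  by rewrite {2 3}PM !mulmxA -(mulmxA P) AkC !mulmxA idP -AkC.
have [W defAk] : exists W, A ^+ k = A ^+ k *m A *m W.
  by apply: rank_mulmx_factorr; rewrite -AkC -AkE rank_mxindex.
exists (P *m A), (A - P *m A); split.
- by rewrite addrC subrK.
- apply/mxindex_eq1; exists (A ^+ k *m W *m W *m Z^t* *m A).
  have -> : P *m A *m (P *m A) = A *m P *m A by rewrite mulmxA PAP.
  have AAk : A *m A ^+ k *m W = A ^+ k by rewrite AkC -defAk.
  (* [W] undoes [A] on the column space of [A ^+ k], which [P] fixes *)
  have APA : A *m P *m A *m (A ^+ k *m W *m W) = A ^+ k.
    rewrite -2!mulmxA (mulmxA A (_ *m W)) (mulmxA A (A ^+ k)) AAk.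
    by rewrite (mulmxA P) idP (mulmxA A) AAk.
  by rewrite {1}PM 2!(mulmxA (A *m P *m A)) APA.
- have powA2 j : (A - P *m A) ^+ j.+1 = A ^+ j.+1 - P *m A ^+ j.+1.
    elim: j => [|j IHj]; first by rewrite !expr1.
    rewrite exprS IHj (exprS A j.+1) -mulmxE mulmxBr !mulmxBl !mulmxA PAP.
    by rewrite subrr subr0.
  have k_gt0 : (0 < k)%N by rewrite /k /mxindex; case: ex_minnP => ? /andP[].
  by move: idP; rewrite -/k -(prednK k_gt0) powA2 => ->; rewrite subrr.
- by rewrite trmxC_mul PC mulmxBr !mulmxA -(mulmxA _ P P) PP subrr.
- by rewrite mulmxBl !mulmxA PAP subrr.
Qed.

(** [A ^+ k] and [A1] have the same column space: [A ^+ k = A1 U + A2 ^+ k],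
    and [A ^+ k *m A1 = A1 ^+ k.+1] where [A1] has index one.  The projector
    onto this space thus fixes [A1] and kills [A2]. *)
Lemma core_EP_projector A A1 A2 Z P :
    is_core_EP A A1 A2 -> P = Z *m (A ^+ mxindex A)^t* ->
    P *m A ^+ mxindex A = A ^+ mxindex A -> A1 = P *m A.
Proof.
case=> defA /mxindex_eq1[Y defA1] nilA2 orthA A21 PZ idP.
have [U defAk] : exists U, A ^+ mxindex A = A1 *m U.
  suff [U] : exists U, A ^+ mxindex A = A1 *m U + A2 ^+ mxindex A.
    by rewrite nilA2 addr0; exists U.
  elim: (mxindex A) => [|j [U IHj]]; first by exists 0; rewrite mulmx0 add0r.
  exists (A1 *m U + A2 ^+ j).
  rewrite exprS IHj (exprS A2) -!mulmxE {1}defA mulmxDl; congr (_ + _).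
  by rewrite mulmxDr mulmxA A21 mul0mx add0r.
have [V defA1k] : exists V, A1 = A ^+ mxindex A *m V.
  elim: (mxindex A) => [|j [V IHj]]; first by exists A1; rewrite mul1mx.
  exists (V *m Y); rewrite exprS -mulmxE mulmxA -(mulmxA A) -IHj.
  by rewrite defA mulmxDl A21 addr0 -defA1.
have PA1 : P *m A1 = A1 by rewrite defA1k mulmxA idP.
have PA2 : P *m A2 = 0.
  by rewrite PZ defAk trmxC_mul -!mulmxA orthA !mulmx0.
by rewrite defA mulmxDr PA1 PA2 addr0.
Qed.

Lemma core_EP_uniq A A1 A2 B1 B2 :
  is_core_EP A A1 A2 -> is_core_EP A B1 B2 -> A1 = B1 /\ A2 = B2.
Proof.
have [Z [P [PZ _ idP]]] := ortho_projector_exists (A ^+ mxindex A).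
move=> epA epB.
have eq1 : A1 = B1.
  by rewrite (core_EP_projector epA PZ idP) (core_EP_projector epB PZ idP).
split=> //; apply: (addrI A1); rewrite {2}eq1.
by have [<- _ _ _ _] := epA; have [<- _ _ _ _] := epB.
Qed.

(** * The C-E order *)

Lemma CE_le_refl A : CE_le A A.
Proof.
have [A1 [A2 epA]] := core_EP_exists A.
exists A1, A2, A1, A2; split=> //; last exact: minus_le_refl.
by have [_ ind1 _ _ _] := epA; apply: sharp_le_refl.
Qed.

Lemma CE_le_trans A B D : CE_le A B -> CE_le B D -> CE_le A D.
Proof.
case=> A1 [A2 [B1 [B2 [epA epB le1 le2]]]].
case=> B1' [B2' [D1 [D2 [epB' epD]]]].
have [<- <-] := core_EP_uniq epB epB' => le1' le2'.
exists A1, A2, D1, D2; split=> //.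
  exact: sharp_le_trans le1 le1'.
exact: minus_le_trans le2 le2'.
Qed.

Lemma CE_le_antisym A B : CE_le A B -> CE_le B A -> A = B.
Proof.
case=> A1 [A2 [B1 [B2 [epA epB le1 le2]]]].
case=> B1' [B2' [A1' [A2' [epB' epA']]]].
have [<- <-] := core_EP_uniq epB epB'; have [<- <-] := core_EP_uniq epA epA'.
move=> ge1 ge2; have [-> _ _ _ _] := epA; have [-> _ _ _ _] := epB.
by rewrite (sharp_le_antisym le1 ge1) (minus_le_antisym le2 ge2).
Qed.

End CoreEP.

Theorem theorem4p3 (R : realType) (n : nat) :
  Relation_Definitions.order 'M[R[i]]_n (@CE_le R[i] n).
Proof.
split=> [A|A B D|A B].
- exact: CE_le_refl.
- exact: CE_le_trans.
- exact: CE_le_antisym.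
Qed.
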